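(* For every integer $k\ge 3$, $$\mathcal D_k^{(k+3)}=(k!)^3\Bigl[\frac{(k+1)^3(k+2)(k+6)}{72}\,\widetilde g_1+\frac{(k+1)^3k(k+2)}{12}\,\widetilde g_2+\frac{(k-1)k(k+1)^2(k+2)(k-2)}{96}\,\widetilde g_3\Bigr].$$ For $k=2$ the same formula holds with the last (zero) term omitted, i.e. $$\mathcal D_2^{(5)}=(2!)^3\Bigl[\frac{3^3\cdot4\cdot8}{72}\,\widetilde g_1+\frac{3^3\cdot2\cdot4}{12}\,\widetilde g_2\Bigr].$$
   Context: Put $n=k+3$, let $x_1,\dots,x_n$ be indeterminates, $P(t)=\prod_{i=1}^n(t-x_i)$, and $\mathcal D_k^{(n)}=\operatorname{disc}(P^{(k)})=(-1)^{m(m-1)/2}c^{-1}\operatorname{Res}(P^{(k)},P^{(k+1)})$, where $m=n-k$ and $c$ is the leading coefficient of $P^{(k)}$. For a loopless multigraph $G$ on the vertex set $\{1,\dots,n\}$ with chosen edge orientations, $M_G=\prod_{(i,j)\in E(G)}(x_i-x_j)$ (edges counted with multiplicity) and $\widetilde G=\sum_{\sigma\in S_n}M_G(x_{\sigma(1)},\dots,x_{\sigma(n)})$ (sum over all $n!$ permutations). The graphs $g_1,g_2,g_3$ are, with isolated vertices adjoined up to $k+3$ vertices: $g_1$ the doubled triangle, $g_2$ the disjoint union of a doubled two-edge path and a doubled edge, $g_3$ the matching of three doubled edges. That is, $$M_{g_1}=(x_1-x_2)^2(x_2-x_3)^2(x_3-x_1)^2,\quad M_{g_2}=(x_1-x_2)^2(x_2-x_3)^2(x_4-x_5)^2,\quad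 M_{g_3}=(x_1-x_2)^2(x_3-x_4)^2(x_5-x_6)^2$$ ($g_3$ requires $k\ge3$). *)

(* Defs.v *)
From mathcomp Require Import all_boot all_order all_fingroup all_algebra.
From mathcomp Require Export mpoly.

Set Implicit Arguments.
Unset Strict Implicit.
Unset Printing Implicit Defensive.

Import GRing.Theory.
Local Open Scope ring_scope.

(* The indeterminates x_1, ..., x_n are the variables 'X_0, ..., 'X_(n-1) of
   {mpoly rat[n]}. *)
Definition genpoly (n : nat) : {poly {mpoly rat[n]}} :=
  \prod_(i < n) ('X - ('X_i)%:P).

(* The leading coefficient inverted here is n!/m!, a unit of {mpoly rat[n]}
   when k <= n, so _^-1 is a true inverse.
   MathComp's Sylvester matrix lists coefficients from the constant term up,
   which changes the usual resultant of polynomials of degrees m and m-1 by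
   (-1)^(m(m-1)) = 1, that is, not at all. *)
Definition discD (n k : nat) : {mpoly rat[n]} :=
  let P := genpoly n in
  let m := (n - k)%N in
  let c := lead_coef P^`(k) in
  (-1) ^+ (m * (m - 1))./2 * c^-1 * resultant P^`(k) P^`(k.+1).

(* Oriented edges, listed with multiplicity. *)
Record multigraph (n : nat) := Multigraph {
  edges : seq ('I_n * 'I_n);
  loopless : all (fun e => e.1 != e.2) edges
}.

Definition graph_monomial n (G : multigraph n) : {mpoly rat[n]} :=
  \prod_(e <- edges G) ('X_(e.1) - 'X_(e.2)).

(* [msym s] substitutes 'X_(s i) for 'X_i; the sum has n! terms and is not
   normalized. *)
Definition graph_sym n (G : multigraph n) : {mpoly rat[n]} :=
  \sum_(s : 'S_n) msym s (graph_monomial G).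

Section AdjoinIsolated.
Variables (m n : nat) (le_mn : (m <= n)%N) (G : multigraph m).

Let widen_edge (e : 'I_m * 'I_m) := (widen_ord le_mn e.1, widen_ord le_mn e.2).

Fact adjoin_isolated_loopless :
  all (fun e => e.1 != e.2) [seq widen_edge e | e <- edges G].
Proof. by rewrite all_map; apply: loopless. Qed.

Definition adjoin_isolated : multigraph n :=
  Multigraph adjoin_isolated_loopless.

End AdjoinIsolated.

Local Notation v n i := (@Ordinal n i isT).

(* Vertices are numbered from 0. *)
Definition g1 : multigraph 3 := @Multigraph 3
  [:: (v 3 0, v 3 1); (v 3 0, v 3 1);
      (v 3 1, v 3 2); (v 3 1, v 3 2);
      (v 3 2, v 3 0); (v 3 2, v 3 0)] isT.

Definition g2 : multigraph 5 := @Multigraph 5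
  [:: (v 5 0, v 5 1); (v 5 0, v 5 1);
      (v 5 1, v 5 2); (v 5 1, v 5 2);
      (v 5 3, v 5 4); (v 5 3, v 5 4)] isT.

Definition g3 : multigraph 6 := @Multigraph 6
  [:: (v 6 0, v 6 1); (v 6 0, v 6 1);
      (v 6 2, v 6 3); (v 6 2, v 6 3);
      (v 6 4, v 6 5); (v 6 4, v 6 5)] isT.

Fact le3_add3 (k : nat) : (3 <= k + 3)%N.
Proof. exact: leq_addl. Qed.

Fact le5_add3 (k : nat) : (2 <= k)%N -> (5 <= k + 3)%N.
Proof. by move=> k2; rewrite -[5%N]/(2 + 3)%N leq_add2r. Qed.

Fact le6_add3 (k : nat) : (3 <= k)%N -> (6 <= k + 3)%N.
Proof. by move=> k3; rewrite -[6%N]/(3 + 3)%N leq_add2r. Qed.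

(* Main.v *)
(* Both sides are written as polynomials in the power sums p_b of the x_i and
   in n = p_0.  On the left, Newton's identities give the top four coefficients
   of P, hence the four coefficients of the cubic P^(k).  On the right, each
   g~ is a combination of sums S(a) over s in S_n of x_s(1)^a_1 ... x_s(r)^a_r.
   Expanding p_b S(a) and collecting the terms in which the new index is one of
   s(1), ..., s(r) gives
     p_b S(a) = sum_j S(a with b added to a_j) + (n - r) S(b :: a),
   so that S(a) is (n - r)! times a polynomial in the power sums.  What remains
   is a polynomial identity.  For k = 2 it holds only with the g3 term included;
   that term vanishes because there are no six distinct indices among five. *)
Require Import Defs.
From mathcomp Require Import all_boot all_order all_fingroup all_algebra.
From mathcomp Require Import ring.
Import GRing.Theory.
Local Open Scope ring_scope.

(** * Augmented monomial symmetric functions *)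

Lemma sum_foldr (V : nmodType) (I : Type) (r : seq I) (F : I -> V) :
  \sum_(i <- r) F i = foldr (fun i s => F i + s) 0 r.
Proof. by elim: r => [|i r IH]; rewrite ?big_nil ?big_cons ?IH. Qed.

(* Sorting only keeps the number of distinct exponent sequences small. *)
Definition bumps (b : nat) (a : seq nat) : seq (seq nat) :=
  [seq sort leq (set_nth 0%N a j (nth 0%N a j + b)%N) | j <- iota 0 (size a)].

(* The augmented monomial symmetric function, i.e. the sum of
   x_i1^a_1 ... x_ir^a_r over distinct i1, ..., ir, for r the size of [a]. *)
Fixpoint augmented {R : nzRingType} (p : nat -> R)
  (r : nat) (a : seq nat) : R :=
  if r is r'.+1 then
    p (head 0%N a) * augmented p r' (behead a)
    - \sum_(c <- bumps (head 0%N a) (behead a)) augmented p r' c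
  else 1.

(** As a [foldr], the sum reduces by simplification once [bumps b a] is a literal list. *)
Lemma augS (R : nzRingType) (p : nat -> R) r b a :
  augmented p r.+1 (b :: a) = p b * augmented p r a
    - foldr (fun c s => augmented p r c + s) 0 (bumps b a).
Proof. by rewrite -sum_foldr. Qed.

Arguments augmented : simpl never.

Lemma size_bumps b a c : c \in bumps b a -> size c = size a.
Proof.
case/mapP=> j; rewrite mem_iota add0n => ja ->.
by rewrite size_sort size_set_nth; apply/maxn_idPr.
Qed.

(* The image of the product of x^a and of the edge factors x_i - x_j under the
   linear map sending each monomial to [F] of its sorted exponents. *)
Fixpoint edge_expansion {V : zmodType} (F : seq nat -> V)
  (E : seq (nat * nat)) (a : seq nat) : V :=
  if E is e :: E' then
    edge_expansion F E' (set_nth 0%N a e.1 (nth 0%N a e.1 + 1))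
    - edge_expansion F E' (set_nth 0%N a e.2 (nth 0%N a e.2 + 1))
  else F (sort leq a).

Definition augmented_graph {R : nzRingType} (p : nat -> R) {m}
    (G : multigraph m) : R :=
  edge_expansion (augmented p m)
    [seq (val e.1, val e.2) | e <- edges G] (nseq m 0%N).

(** * Sums of monomials over the symmetric group *)

Section Symmetrization.
Variable (n : nat).
Local Notation R := {mpoly rat[n]}.

Definition symsum (f : R) : R := \sum_(s : 'S_n) msym s f.

Lemma symsumB f g : symsum (f - g) = symsum f - symsum g.
Proof. by rewrite -sumrB; apply: eq_bigr => s _; rewrite msymB. Qed.

Lemma symsum_msym t f : symsum (msym t f) = symsum f.
Proof.
rewrite /symsum [RHS](reindex_inj (mulgI t)).
by apply: eq_bigr => s _; rewrite msymMm.
Qed.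

Definition psum (b : nat) : R := \sum_(i < n) 'X_i ^+ b.

Definition mon (a : seq nat) : R := \prod_(i < n) 'X_i ^+ nth 0%N a i.

Lemma mpoly_mulrIn m : (0 < m)%N -> injective (fun f : R => f *+ m).
Proof.
move=> m0 f g /= /(congr1 (GRing.scale (m%:R^-1 : rat))).
have mU : (m%:R^-1 : rat) *+ m = 1.
  by rewrite -[LHS]mulr_natr mulVf // Num.Theory.pnatr_eq0 -lt0n.
by rewrite -!scalerMnr !scalerMnl mU !scale1r.
Qed.

Lemma msymXn s f b : msym s (f ^+ b) = msym s f ^+ b :> R.
Proof. exact: rmorphXn. Qed.

Lemma msymXi (s : 'S_n) i : msym s 'X_i = 'X_(s i) :> R.
Proof. by rewrite /msym mmapX mmap1U. Qed.

Lemma msym_mon s a : msym s (mon a) = \prod_(i < n) 'X_(s i) ^+ nth 0%N a i.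
Proof.
by rewrite /mon (rmorph_prod (msym s)); apply: eq_bigr => i _; rewrite /= msymXn msymXi.
Qed.

Lemma msym_psum s b : msym s (psum b) = psum b.
Proof.
rewrite /psum raddf_sum [RHS](reindex_inj (@perm_inj _ s)).
by apply: eq_bigr => i _; rewrite /= msymXn msymXi.
Qed.

Lemma psum_symsum b f : psum b * symsum f = \sum_(i < n) symsum ('X_i ^+ b * f).
Proof.
rewrite /symsum mulr_sumr [RHS]exchange_big; apply: eq_bigr => s _ /=.
by rewrite -(msym_psum s) -msymM mulr_suml raddf_sum.
Qed.

Lemma mon_set_nth (i : 'I_n) b a :
  'X_i ^+ b * mon a = mon (set_nth 0%N a i (nth 0%N a i + b)).
Proof.
rewrite /mon (bigD1 i) //= [RHS](bigD1 i) //= nth_set_nth /= eqxx exprD mulrA.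
rewrite [_ * 'X_i ^+ b]mulrC; congr (_ * _); apply: eq_bigr => j ji.
by rewrite nth_set_nth /= -[_ == _ :> nat]/(j == i) (negPf ji).
Qed.

Lemma mon_pad a m : mon (a ++ nseq m 0%N) = mon a.
Proof.
apply: eq_bigr => i _; rewrite nth_cat nth_nseq if_same.
by case: ltnP => // ai; rewrite nth_default.
Qed.

(** Padded with zeros to length n, the two sequences differ by a permutation of the variables, which
    [symsum] absorbs. *)
Lemma perm_symsum_mon {a b} : (size a <= n)%N -> perm_eq a b ->
  symsum (mon a) = symsum (mon b).
Proof.
move=> an ab; have bn : (size b <= n)%N by rewrite -(perm_size ab).
rewrite -(mon_pad a (n - size a)) -(mon_pad b (n - size b)).
rewrite -(perm_size ab); set z := nseq _ _.
have sb : size (b ++ z) == n by rewrite size_cat size_nseq (perm_size ab) subnKC.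
have : perm_eq (a ++ z) (Tuple sb) by rewrite /= perm_cat2r.
case/tuple_permP=> s ->; rewrite -[LHS](symsum_msym s); congr symsum.
rewrite msym_mon [RHS](reindex_inj (@perm_inj _ s)); apply: eq_bigr => i _.
by rewrite -[nth _ _ i](@tnth_nth n) tnth_mktuple (tnth_nth 0%N).
Qed.

(** The indices below [size a] give the bumps. All other indices give the same term, since a
    transposition moves each of them to position [size a]. *)
Lemma psum_symsum_mon b a : (size a <= n)%N ->
  psum b * symsum (mon a) =
    \sum_(c <- bumps b a) symsum (mon c) + symsum (mon (b :: a)) *+ (n - size a).
Proof.
move=> an; rewrite psum_symsum.
rewrite (bigID (fun i : 'I_n => i < size a)%N) /=; congr (_ + _).
  rewrite big_map -[X in iota 0 X]subn0 big_mkord.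
  pose F (j : nat) := symsum (mon (sort leq (set_nth 0%N a j (nth 0%N a j + b)))).
  rewrite (big_ord_widen n F an); apply: eq_bigr => i ia; rewrite mon_set_nth.
  apply: perm_symsum_mon; last by rewrite perm_sym perm_sort.
  by rewrite size_set_nth (maxn_idPr ia).
rewrite (eq_bigr (fun=> symsum (mon (b :: a)))) => [|i].
  rewrite sumr_const; congr (_ *+ _).
  rewrite -[RHS]/(n - size a)%N -sum1_card.
  rewrite (eq_bigl (fun i : 'I_n => ~~ (i < size a)%N)) //.
  have := sum1_card 'I_n; rewrite card_ord (bigID (fun i : 'I_n => i < size a)%N) /=.
  by rewrite -(big_ord_widen n (fun=> 1%N) an) sum1_card card_ord => /(canRL (addKn _)).
rewrite -leqNgt => ai; have lan := leq_ltn_trans ai (ltn_ord i).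
(* [t] only moves positions beyond the end of [a], so it fixes [mon a]. *)
pose t := tperm (Ordinal lan) i.
rewrite (perm_symsum_mon (b := rcons a b)) 1?perm_sym ?perm_rcons //.
rewrite -(symsum_msym t (mon _)); congr symsum.
have -> : rcons a b = set_nth 0%N a (size a) (nth 0%N a (size a) + b).
  by rewrite nth_default //; elim: (a) => //= x l ->.
rewrite -(mon_set_nth (Ordinal lan)) msymM msymXn msymXi tpermL msym_mon.
congr (_ * _); apply: eq_bigr => j _.
case: (ltnP j (size a)) => ja; last by rewrite nth_default.
by rewrite tpermD // -val_eqE /= gtn_eqF // (leq_trans ja).
Qed.

Lemma augmentedE r a : size a = r -> (r <= n)%N ->
  symsum (mon a) = augmented psum r a *+ (n - r)`!.
Proof.
elim: r a => [|r IH] [|b a] // => [_ _ | [sa] rn].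
  rewrite subn0 /symsum /mon (eq_bigr (fun=> 1)).
    by rewrite sumr_const card_Sn.
  by move=> s _; rewrite big1 ?msym1 // => i _; rewrite nth_nil.
have rn' := ltnW rn.
have nr : (0 < n - r)%N by rewrite subn_gt0.
(* After multiplication by n - r, the left side is the last term of [psum_symsum_mon], and (n - r)
   (n - r - 1)! = (n - r)! matches the factorials. *)
apply: (@mpoly_mulrIn (n - r) nr) => /=.
have := psum_symsum_mon b a; rewrite sa => /(_ rn') /esym /(canRL (addKr _)) ->.
rewrite augS -sum_foldr (IH _ sa rn').
rewrite (eq_big_seq (fun c => augmented psum r c *+ (n - r)`!)); last first.
  by move=> c /size_bumps sc; apply: IH; rewrite // sc.
rewrite sumrMnl mulrnAr addrC -mulrnBl -mulrnA; congr (_ *+ _).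
by rewrite -[in LHS](subnSK rn) factS subnSK // mulnC.
Qed.

(** Behind the first exponent there are n others, so the last term of [psum_symsum_mon] has
    multiplicity n - n = 0. *)
Lemma augmented_eq0 a : size a = n.+1 -> augmented psum n.+1 a = 0.
Proof.
case: a => // b a [sa]; rewrite augS -sum_foldr.
have := psum_symsum_mon b a; rewrite sa => /(_ (leqnn _)).
rewrite subnn addr0 (augmentedE _ _ sa (leqnn _)) subnn mulr1n => ->.
apply/eqP; rewrite subr_eq0; apply/eqP/eq_big_seq => c /size_bumps sc.
by rewrite (augmentedE n) ?sc // subnn.
Qed.

(** In the induction, [a] accumulates the exponents chosen from the edges already expanded. *)
Lemma symsum_edges r (rn : (r <= n)%N) (E : seq ('I_r * 'I_r)) a : size a = r ->
  symsum (\prod_(e <- E) ('X_(widen_ord rn e.1) - 'X_(widen_ord rn e.2)) * mon a) =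
  edge_expansion (augmented psum r) [seq (val e.1, val e.2) | e <- E] a *+ (n - r)`!.
Proof.
elim: E a => [|[i j] E IH] a sa.
  rewrite big_nil mul1r /= -augmentedE ?size_sort //; apply: perm_symsum_mon.
    by rewrite sa.
  by rewrite perm_sym perm_sort.
rewrite big_cons -mulrA mulrBl symsumB; set P := \prod_(e <- E) _.
have shift (l : 'I_r) : 'X_(widen_ord rn l) * (P * mon a) =
    P * mon (set_nth 0%N a l (nth 0%N a l + 1)).
  by rewrite mulrCA -{1}['X_(widen_ord rn l)]expr1 mon_set_nth.
rewrite !shift !IH ?size_set_nth ?sa; try exact/maxn_idPr/ltn_ord.
by rewrite -mulrnBl.
Qed.

End Symmetrization.

(** * Graph sums in terms of power sums *)

Lemma graph_sym_adjoin m n (le_mn : (m <= n)%N) (G : multigraph m) :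
  graph_sym (adjoin_isolated le_mn G) = augmented_graph (psum n) G *+ (n - m)`!.
Proof.
rewrite /augmented_graph -(symsum_edges n m le_mn) ?size_nseq // -[nseq m _]cat0s mon_pad.
rewrite [mon _ [::]]big1 => [|i _]; last by rewrite nth_nil.
by rewrite mulr1 /graph_sym /graph_monomial /= big_map.
Qed.

Lemma graph_sym_adjoin0 n (G : multigraph n) :
  graph_sym (adjoin_isolated (leqnn n) G) = graph_sym G.
Proof.
apply: eq_bigr => s _; congr msym; rewrite /graph_monomial /= big_map.
by apply: eq_bigr => e _ /=; congr ('X_ _ - 'X_ _); apply: val_inj.
Qed.

(** Each step rewrites all copies of one augmented function at once; computing the bumps to literals
    makes equal copies syntactically equal. *)
Ltac augmented_step :=
  rewrite augS;
  match goal with |- context [bumps ?b ?a] =>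
    let L := eval vm_compute in (bumps b a) in
    change (bumps b a) with L; rewrite [foldr _ _ _]/=
  end.

Ltac sort_step :=
  match goal with |- context [sort ?r ?a] =>
    let L := eval vm_compute in (sort r a) in change (sort r a) with L
  end.

(** With [F] arbitrary, [ring] collects the 2^6 signed terms by sorted exponent sequence. *)
Lemma g1_expansion (R : comNzRingType) (F : seq nat -> R) :
  edge_expansion F [:: (0, 1); (0, 1); (1, 2); (1, 2); (2, 0); (2, 0)]%N (nseq 3 0%N) =
    6 * F [:: 0; 2; 4]%N - 6 * F [:: 1; 1; 4]%N - 6 * F [:: 0; 3; 3]%N
    + 12 * F [:: 1; 2; 3]%N - 6 * F [:: 2; 2; 2]%N.
Proof. by rewrite [edge_expansion _ _ _]/edge_expansion; repeat sort_step; ring. Qed.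

Lemma g2_expansion (R : comNzRingType) (F : seq nat -> R) :
  edge_expansion F [:: (0, 1); (0, 1); (1, 2); (1, 2); (3, 4); (3, 4)]%N (nseq 5 0%N) =
    2 * F [:: 0; 0; 0; 2; 4]%N - 8 * F [:: 0; 0; 1; 2; 3]%N + 6 * F [:: 0; 0; 2; 2; 2]%N
    - 2 * F [:: 0; 0; 1; 1; 4]%N + 8 * F [:: 0; 1; 1; 1; 3]%N - 6 * F [:: 0; 1; 1; 2; 2]%N.
Proof. by rewrite [edge_expansion _ _ _]/edge_expansion; repeat sort_step; ring. Qed.

Lemma g3_expansion (R : comNzRingType) (F : seq nat -> R) :
  edge_expansion F [:: (0, 1); (0, 1); (2, 3); (2, 3); (4, 5); (4, 5)]%N (nseq 6 0%N) =
    8 * F [:: 0; 0; 0; 2; 2; 2]%N - 24 * F [:: 0; 0; 1; 1; 2; 2]%N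
    + 24 * F [:: 0; 1; 1; 1; 1; 2]%N - 8 * F [:: 1; 1; 1; 1; 1; 1]%N.
Proof. by rewrite [edge_expansion _ _ _]/edge_expansion; repeat sort_step; ring. Qed.

(** An exponent 0 leaves its index free apart from the r indices already used. In the recursion,
    bumping by 0 yields r copies of [a], which is already sorted. *)
Lemma augmented0 (R : comNzRingType) (p : nat -> R) r a : size a = r -> sorted leq a ->
  augmented p r.+1 (0%N :: a) = (p 0%N - r%:R) * augmented p r a.
Proof.
move=> sa sorta /=; rewrite [LHS]/augmented -/augmented [behead _]/=.
rewrite (eq_big_seq (fun=> augmented p r a)) => [|c].
  by rewrite big_const_seq count_predT size_map size_iota sa iter_addr_0 mulrBl mulr_natl.
case/mapP=> j; rewrite mem_iota => /andP[_ ja] ->; congr augmented.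
rewrite addn0 (_ : set_nth _ _ _ _ = a).
  by rewrite sorted_sort //; exact: leq_trans.
apply: (@eq_from_nth _ 0%N) => [|i _].
  by rewrite size_set_nth; apply/maxn_idPr.
by rewrite nth_set_nth /=; case: eqP => // ->.
Qed.

(** This is 288 times the theorem, for K = k and F = (k - 2)!. The letters a, b, c, d are 6, 2, 2, 6
    times the coefficients of P^(k). The factorials from the graph sums are k! = K (K - 1) F, F, and
    (k - 3)!, the last of which becomes F with the factor K - 2 of its weight. *)
Lemma power_sum_identity (R : comNzRingType) (p : nat -> R) (K F : R) :
  p 0%N = K + 3 -> let kf := K * (K - 1) * F in
  let a := (K + 3) * (K + 2) * (K + 1) * kf in
  let b := - p 1%N * (K + 2) * (K + 1) * kf in
  let c := (p 1%N ^+ 2 - p 2%N) * (K + 1) * kf in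
  let d := - (p 1%N ^+ 3 - 3 * p 1%N * p 2%N + 2 * p 3%N) * kf in
  18 * b ^+ 2 * c ^+ 2 - 24 * a * c ^+ 3 - 24 * b ^+ 3 * d
    - 6 * a ^+ 2 * d ^+ 2 + 36 * a * b * c * d =
  kf ^+ 3 * F *
   (4 * (K + 1) ^+ 3 * (K + 2) * (K + 6) * K * (K - 1) *
      augmented_graph p g1
    + 24 * (K + 1) ^+ 3 * K * (K + 2) * augmented_graph p g2
    + 3 * (K - 1) * K * (K + 1) ^+ 2 * (K + 2) * augmented_graph p g3).
Proof.
move=> p0 kf a b c d; rewrite /augmented_graph [nseq 3 _]/= ![map _ _]/=.
rewrite g1_expansion g2_expansion g3_expansion !augmented0 // p0.
repeat augmented_step.
by rewrite ![augmented _ 0 _]/augmented /a /b /c /d /kf; ring.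
Qed.

(** * The discriminant of a cubic as a resultant *)

Fixpoint laplace {R : comNzRingType} (n : nat) (g : nat -> nat -> R) : R :=
  if n is m.+1 then
    foldr (fun j s => g 0%N j * ((-1) ^+ j * laplace m (fun i l => g i.+1 (bump j l))) + s)
      0 (iota 0 n)
  else 1.

(** Unlike [\det], [laplace] reduces by simplification on a concrete matrix. *)
Lemma det_laplace (R : comNzRingType) n (g : nat -> nat -> R) :
  \det (\matrix_(i < n, j < n) g i j) = laplace n g.
Proof.
elim: n g => [|n IH] g; first by rewrite det_mx00.
rewrite (expand_det_row _ ord0).
pose F j := g 0%N j * ((-1) ^+ j * laplace n (fun i l => g i.+1 (bump j l))).
transitivity (\sum_(j < n.+1) F j).
  apply: eq_bigr => j _; rewrite mxE /F /cofactor add0n -IH; congr (_ * (_ * \det _)).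
  by apply/matrixP => i l; rewrite !mxE.
by rewrite -(big_mkord xpredT F) sum_foldr.
Qed.

(** The rows form the Sylvester matrix of d + c X + b X^2 + a X^3 and its derivative, constant terms
    first; the last factor is the discriminant. *)
Lemma det_cubic (R : comNzRingType) (a b c d : R) :
  let rows := [:: [:: d; c; b; a; 0]; [:: 0; d; c; b; a];
    [:: c; 2 * b; 3 * a; 0; 0]; [:: 0; c; 2 * b; 3 * a; 0]; [:: 0; 0; c; 2 * b; 3 * a]] in
  \det (\matrix_(i < 5, j < 5) nth 0 (nth [::] rows i) j) =
    - a * (b ^+ 2 * c ^+ 2 - 4 * a * c ^+ 3 - 4 * b ^+ 3 * d
      - 27 * a ^+ 2 * d ^+ 2 + 18 * a * b * c * d).
Proof.
move=> rows.
rewrite (det_laplace _ _ (fun i j => nth 0 (nth [::] rows i) j)).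
by rewrite {}/rows /=; ring.
Qed.

Lemma resultant_deriv_cubic (R : comNzRingType) (p : {poly R}) :
  size p = 4%N -> size p^`() = 3%N ->
  let a := p`_3 in let b := p`_2 in let c := p`_1 in let d := p`_0 in
  resultant p p^`() = - a * (b ^+ 2 * c ^+ 2 - 4 * a * c ^+ 3 - 4 * b ^+ 3 * d
    - 27 * a ^+ 2 * d ^+ 2 + 18 * a * b * c * d).
Proof.
move=> sp sq a b c d; pose m := (size p^`()).-1.
pose g i j := if (i < m)%N then p`_(j - i) *+ (i <= j)
  else p^`()`_(j - (i - m)) *+ (i - m <= j).
have -> : resultant p p^`() = \det (\matrix_(i < m + (size p).-1, j < m + (size p).-1) g i j).
  congr (\det _); apply/matrixP => i j; rewrite Sylvester_mxE mxE /g.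
  by case: splitP => l -> //; rewrite addKn.
(* Some zero entries of the matrix are read as coefficients beyond the degree. *)
have [p4 p5] : p`_4 = 0 /\ p`_5 = 0 by rewrite !nth_default // sp.
rewrite -det_cubic {}/g {}/m sp sq /=; congr (\det _); apply/matrixP => i j; rewrite !mxE.
case: i j => [[|[|[|[|[|i]]]]] // hi] [[|[|[|[|[|j]]]]] // hj];
  rewrite /= ?(subSS, subn0, sub0n) ?coef_deriv ?p4 ?p5 ?mulr0n ?mulr1n ?mul0rn ?mulr_natl //.
Qed.

(** * Coefficients of P and of its k-th derivative *)

(* The factor 'X^3 avoids negative indices for short [l]. *)
Lemma coef_prod_XsubC (R : comNzRingType) (l : seq R) :
  let s i := \sum_(x <- l) x ^+ i in
  let P := \prod_(x <- l) ('X - x%:P) * 'X^3 in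
  [/\ P`_(size l).+3 = 1, P`_(size l).+2 = - s 1%N,
      2 * P`_(size l).+1 = s 1%N ^+ 2 - s 2%N
    & 6 * P`_(size l) = - (s 1%N ^+ 3 - 3 * s 1%N * s 2%N + 2 * s 3%N)].
Proof.
elim: l => [|x l /= [h0 h1 h2 h3]] /=.
  by rewrite !big_nil mul1r !coefXn /=; split; ring.
rewrite !big_cons -mulrA; set P := _ * 'X^3 in h0 h1 h2 h3 *.
have hc m : (('X - x%:P) * P)`_m.+1 = P`_m - x * P`_m.+1.
  by rewrite mulrBl coefB coefXM coefCM.
have h4 : P`_(size l).+4 = 0.
  by rewrite /P coefMXn /= nth_default // size_prod_XsubC //.
have h5 : 6 * P`_(size l).+1 = 3 * (2 * P`_(size l).+1) by ring.
rewrite !hc h4 !mulrBr ![_ * (x * _)]mulrCA h0 h1 h5 h2 h3.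
by split; ring.
Qed.

(** The indices stay in the form k + i, in which [coef_derivn] produces them. *)
Lemma coef_genpoly k : let P := genpoly (k + 3) in let p := psum (k + 3) in
  [/\ P`_(k + 3) = 1, P`_(k + 2) = - p 1%N, 2 * P`_(k + 1) = p 1%N ^+ 2 - p 2%N
    & 6 * P`_(k + 0) = - (p 1%N ^+ 3 - 3 * p 1%N * p 2%N + 2 * p 3%N)].
Proof.
move=> P p; set n := (k + 3)%N in P p *.
pose l : seq {mpoly rat[n]} := [seq 'X_i | i <- enum 'I_n].
have sl : size l = n by rewrite size_map size_enum_ord.
have Pl : P = \prod_(x <- l) ('X - x%:P) by rewrite big_map big_enum.
have pl b : p b = \sum_(x <- l) x ^+ b by rewrite big_map big_enum.
have := coef_prod_XsubC _ l; cbv zeta; rewrite -Pl sl -!pl => -[h3 h2 h1 h0].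
have shift i m : (k + i + 3)%N = m -> P`_(k + i) = (P * 'X^3)`_m.
  by move<-; rewrite coefMXn ltnNge leq_addl addnK.
have e3 : (k + 3 + 3)%N = n.+3 by rewrite /n !addnS !addn0.
have e2 : (k + 2 + 3)%N = n.+2 by rewrite /n !addnS !addn0.
have e1 : (k + 1 + 3)%N = n.+1 by rewrite /n !addnS !addn0.
have e0 : (k + 0 + 3)%N = n by rewrite addn0.
by rewrite (shift 3 _ e3) (shift 2 _ e2) (shift 1 _ e1) (shift 0 _ e0).
Qed.

Lemma natr_mpoly_unit n m : (0 < m)%N -> m%:R \is a @GRing.unit {mpoly rat[n]}.
Proof.
move=> m0; rewrite -(rmorph_nat (@mpolyC n rat)) rmorph_unit //.
by rewrite unitfE Num.Theory.pnatr_eq0 -lt0n.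
Qed.

Lemma ffact_natr (R : comNzRingType) k (K := k%:R : R) (f := k`!%:R : R) :
  [/\ 6 * ((k + 3) ^_ k)%:R = (K + 3) * (K + 2) * (K + 1) * f,
      2 * ((k + 2) ^_ k)%:R = (K + 2) * (K + 1) * f,
      ((k + 1) ^_ k)%:R = (K + 1) * f & ((k + 0) ^_ k)%:R = f].
Proof.
have H j : j`!%:R * ((k + j) ^_ k)%:R = (k + j)`!%:R :> R.
  by rewrite -natrM mulnC -(ffact_fact (leq_addr j k)) addKn.
move: (H 3%N) (H 2%N) (H 1%N) (H 0%N).
rewrite addn3 addn2 addn1 addn0 !factS !natrM -!natr1 => h3 h2 h1 h0.
by split; [ring: h3 | ring: h2 | ring: h1 | ring: h0].
Qed.

Lemma fact_predpred (R : comNzRingType) k : (2 <= k)%N ->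
  k`!%:R = k%:R * (k%:R - 1) * (k - 2)`!%:R :> R.
Proof.
by case: k => [|[|k]] // _; rewrite subSS subn1 !factS !natrM -!natr1; ring.
Qed.

(* 288 clears all the denominators 72, 12, 96 and those of a6/6, b2/2, c2/2, d6/6. *)
Lemma cubic_disc_scale (R : comNzRingType) (a b c d a6 b2 c2 d6 : R) :
  6 * a = a6 -> 2 * b = b2 -> 2 * c = c2 -> 6 * d = d6 ->
  (b ^+ 2 * c ^+ 2 - 4 * a * c ^+ 3 - 4 * b ^+ 3 * d - 27 * a ^+ 2 * d ^+ 2
    + 18 * a * b * c * d) *+ 288 =
  18 * b2 ^+ 2 * c2 ^+ 2 - 24 * a6 * c2 ^+ 3 - 24 * b2 ^+ 3 * d6
    - 6 * a6 ^+ 2 * d6 ^+ 2 + 36 * a6 * b2 * c2 * d6.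
Proof. by move=> <- <- <- <-; ring. Qed.

(** P^(k) is a cubic with leading coefficient [a]. Its resultant is -a times the cubic discriminant,
    and the sign and c^-1 remove the factor -a. *)
Lemma discD_coef k (P := genpoly (k + 3))
    (a := P`_(k + 3) *+ (k + 3) ^_ k) (b := P`_(k + 2) *+ (k + 2) ^_ k)
    (c := P`_(k + 1) *+ (k + 1) ^_ k) (d := P`_(k + 0) *+ (k + 0) ^_ k) :
  discD (k + 3) k = b ^+ 2 * c ^+ 2 - 4 * a * c ^+ 3 - 4 * b ^+ 3 * d
    - 27 * a ^+ 2 * d ^+ 2 + 18 * a * b * c * d.
Proof.
have [P3 _ _ _] := coef_genpoly k.
have sP : size P = (k + 4)%N.
  by rewrite /P /genpoly -big_enum size_prod_XsubC size_enum_ord -addnS.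
(* The degrees 3 and 2 require a and 3 a to be nonzero, and c^-1 requires a to be invertible. *)
have aU m : (0 < m)%N -> (a *+ m) \is a GRing.unit.
  move=> m0; rewrite /a P3 -mulrnA natr_mpoly_unit // muln_gt0 m0 andbT.
  by rewrite ffact_gt0 leq_addr.
have neq0 (x : {mpoly rat[k + 3]}) : x \is a GRing.unit -> x != 0.
  by apply: contraTneq => ->; rewrite unitr0.
have sQ : size P^`(k) = 4%N.
  apply/anti_leq/andP; split.
    apply/leq_sizeP => i i4; rewrite coef_derivn nth_default ?mul0rn //.
    by rewrite sP leq_add2l.
  rewrite ltnNge; apply/negP => /leq_sizeP /(_ 3 (leqnn _)) /eqP.
  by rewrite coef_derivn -/a; apply/negP/neq0/(aU 1%N).
have sQ' : size P^`(k)^`() = 3%N.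
  apply/anti_leq/andP; split.
    by apply/leq_sizeP => i i3; rewrite coef_deriv nth_default ?mul0rn ?sQ.
  rewrite ltnNge; apply/negP => /leq_sizeP /(_ 2 (leqnn _)) /eqP.
  by rewrite coef_deriv coef_derivn -/a; apply/negP/neq0/aU.
rewrite /discD -/P derivnS resultant_deriv_cubic // lead_coefE sQ !coef_derivn.
rewrite addKn -/a -/b -/c -/d; set D := (X in - a * X).
(* Here m = 3, so the exponent m (m - 1) / 2 is 3. *)
rewrite (_ : (_ ^+ _) = -1); last by rewrite -signr_odd.
by rewrite !mulNr mul1r mulrN opprK mulKr // (aU 1%N).
Qed.

Lemma discD_augmented k (k2 : (2 <= k)%N) (p := psum (k + 3))
    (K : {mpoly rat[k + 3]} := k%:R) (kf : {mpoly rat[k + 3]} := k`!%:R)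
    (F : {mpoly rat[k + 3]} := (k - 2)`!%:R) :
  discD (k + 3) k *+ 288 = kf ^+ 3 * F *
   (4 * (K + 1) ^+ 3 * (K + 2) * (K + 6) * K * (K - 1) *
      augmented_graph p g1
    + 24 * (K + 1) ^+ 3 * K * (K + 2) * augmented_graph p g2
    + 3 * (K - 1) * K * (K + 1) ^+ 2 * (K + 2) * augmented_graph p g3).
Proof.
have kfE : kf = K * (K - 1) * F by exact: fact_predpred.
have p0 : p 0%N = K + 3.
  rewrite /p /psum (eq_bigr (fun=> 1)) => [|i _]; last by rewrite expr0.
  by rewrite sumr_const card_ord natrD.
have [P3 P2 P1 P0] := coef_genpoly k; rewrite -/p in P3 P2 P1 P0.
have [f3 f2 f1 f0] := ffact_natr {mpoly rat[k + 3]} k; rewrite -/K -/kf in f3 f2 f1 f0.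
rewrite {1}kfE -(power_sum_identity _ p K F p0) /= -kfE discD_coef.
apply: cubic_disc_scale; rewrite -[_ *+ _ ^_ _]mulr_natr mulrA.
- by rewrite P3 mulr1.
- by rewrite P2 mulrAC mulrC f2; ring.
- by rewrite P1 f1; ring.
- by rewrite P0 f0.
Qed.

(** * Clearing denominators and conclusion *)

Lemma scale_divn n (c : rat) (d e : nat) (v : {mpoly rat[n]}) : (0 < d)%N ->
  ((c / d%:R) *: v) *+ (d * e) = (c *+ e) *: v.
Proof.
move=> d0; rewrite scalerMnl; congr (_ *: _).
by rewrite mulrnA -[_ *+ d]mulr_natr divfK // Num.Theory.pnatr_eq0 -lt0n.
Qed.

(** Applied to [mpolyC], this turns the rational weights into constants of the polynomial ring,
    where [ring] treats the whole identity. *)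
Lemma rmorph_weights (R : comNzRingType) (f : {rmorphism rat -> R}) (k : nat)
    (K := k%:R : rat) (k' := k%:R : R) :
  [/\ f (k`!%:R ^+ 3) = k`!%:R ^+ 3,
      f ((K + 1) ^+ 3 * (K + 2) * (K + 6) *+ 4) =
        4 * (k' + 1) ^+ 3 * (k' + 2) * (k' + 6),
      f ((K + 1) ^+ 3 * K * (K + 2) *+ 24) = 24 * (k' + 1) ^+ 3 * k' * (k' + 2)
    & f ((K - 1) * K * (K + 1) ^+ 2 * (K + 2) * (K - 2) *+ 3) =
        3 * (k' - 1) * k' * (k' + 1) ^+ 2 * (k' + 2) * (k' - 2)].
Proof.
by rewrite /K /k'; split; ring.
Qed.

(* [X3] stands for g~3, which only exists when k >= 3; take X3 = 0 if k = 2. *)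
Lemma discD_graph_sym k (k2 : (2 <= k)%N) (K := k%:R : rat)
    (X3 : {mpoly rat[k + 3]}) :
  (k%:R - 2) * X3 = (k - 2)`!%:R * augmented_graph (psum (k + 3)) g3 ->
  discD (k + 3) k = (k`!%:R ^+ 3 : rat) *:
    (((K + 1) ^+ 3 * (K + 2) * (K + 6) / 72)
        *: graph_sym (adjoin_isolated (le3_add3 k) g1)
     + ((K + 1) ^+ 3 * K * (K + 2) / 12)
        *: graph_sym (adjoin_isolated (le5_add3 k2) g2)
     + ((K - 1) * K * (K + 1) ^+ 2 * (K + 2) * (K - 2) / 96) *: X3).
Proof.
move=> X3E; apply: (mpoly_mulrIn (k + 3) 288 isT); cbv beta.
rewrite [RHS]scalerMnr !mulrnDl (scale_divn _ _ 72 4) // (scale_divn _ _ 12 24) //.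
rewrite (scale_divn _ _ 96 3) // discD_augmented // !graph_sym_adjoin -!mul_mpolyC.
have [-> -> -> ->] := rmorph_weights _ (@mpolyC (k + 3) rat) k.
have -> : (k + 3 - 3 = k)%N by rewrite addnK.
have -> : (k + 3 - 5 = k - 2)%N by rewrite (subnDr 3 k 2).
rewrite -[_ * (k%:R - 2) * X3]mulrA X3E.
set A1 := augmented_graph _ g1; set A2 := augmented_graph _ g2.
rewrite -[A1 *+ _]mulr_natl -[A2 *+ _]mulr_natl.
(* Only the k! coming from g~1 is expanded; the prefactor (k!)^3 stays an atom on both sides. *)
have -> : k`!%:R * A1 = k%:R * (k%:R - 1) * (k - 2)`!%:R * A1.
  by rewrite fact_predpred.
ring.
Qed.

Theorem corollary23 :
  (forall (k : nat) (hk : (3 <= k)%N),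
     let K : rat := k%:R in
     let G1 := adjoin_isolated (le3_add3 k) g1 in
     let G2 := adjoin_isolated (le5_add3 (ltnW hk)) g2 in
     let G3 := adjoin_isolated (le6_add3 hk) g3 in
     discD (k + 3) k =
       ((k`!)%:R ^+ 3 : rat) *:
         (((K + 1) ^+ 3 * (K + 2) * (K + 6) / 72) *: graph_sym G1
          + ((K + 1) ^+ 3 * K * (K + 2) / 12) *: graph_sym G2
          + ((K - 1) * K * (K + 1) ^+ 2 * (K + 2) * (K - 2) / 96)
              *: graph_sym G3))
  /\
  (let G1 : multigraph 5 := adjoin_isolated (le3_add3 2) g1 in
   let G2 : multigraph 5 := g2 in
   discD 5 2 =
     ((2`!)%:R ^+ 3 : rat) *:
       ((3 ^+ 3 * 4 * 8 / 72 : rat) *: graph_sym G1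
        + (3 ^+ 3 * 2 * 4 / 12 : rat) *: graph_sym G2)).
Proof.
split=> [k hk K G1 G2 G3|G1 G2].
  apply: discD_graph_sym; rewrite graph_sym_adjoin -[augmented_graph _ _ *+ _]mulr_natl mulrA.
  (* What remains is (k - 2) (k - 3)! = (k - 2)!. *)
  congr (_ * _); rewrite (subnDr 3 k 3) -natrB ?(ltnW hk) // -natrM.
  by rewrite -[in RHS](subnSK hk) factS subnSK.
have := discD_graph_sym 2 isT 0; rewrite mulr0 scaler0 addr0 => -> //; last first.
  by rewrite /augmented_graph g3_expansion !augmented_eq0 // !mulr0 !subr0 addr0 mulr0.
rewrite -[graph_sym G2]graph_sym_adjoin0.
congr (_ *: (_ *: _ + _ *: graph_sym (adjoin_isolated _ _))).
(* The two embeddings of [g2] differ only in their proofs of 5 <= 5. *)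
exact: bool_irrelevance.
Qed.
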